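(* Let $(\mathscr A,\mathscr B,\mathscr C)$ be a recollement of abelian categories (with enough projectives and enough injectives). Assume that $\operatorname{pgl.dim}_{\mathscr B}\mathscr A\le1$. Then $$\max\{\operatorname{Fin.dim}\mathscr A,\operatorname{Fin.dim}\mathscr C\}\le\operatorname{Fin.dim}\mathscr B\le\operatorname{Fin.dim}\mathscr C+2.$$ In particular, $\operatorname{Fin.dim}\mathscr B<\infty$ if and only if $\operatorname{Fin.dim}\mathscr C<\infty$.
   Context: A recollement $(\mathscr A,\mathscr B,\mathscr C)$ of abelian categories consists of functors $\mathsf i\colon\mathscr A\to\mathscr B$, $\mathsf e\colon\mathscr B\to\mathscr C$, $\mathsf q,\mathsf p\colon\mathscr B\to\mathscr A$, $\mathsf l,\mathsf r\colon\mathscr C\to\mathscr B$ such that $(\mathsf l,\mathsf e)$, $(\mathsf e,\mathsf r)$, $(\mathsf q,\mathsf i)$, $(\mathsf i,\mathsf p)$ are adjoint pairs, the functors $\mathsf i,\mathsf l,\mathsf r$ are fully faithful, and the essential image of $\mathsf i$ equals $\operatorname{Ker}\mathsf e=\{B\in\mathscr B\mid\mathsf e(B)=0\}$. The $\mathscr A$-relative projective global dimension of $\mathscr B$ is $\operatorname{pgl.dim}_{\mathscr B}\mathscr A=\sup\{\operatorname{pd}_{\mathscr B}\mathsf i(A)\mid A\in\mathscr A\}$. For an abelian category $\mathscr A$ with enough projectives, $\operatorname{Fin.dim}\mathscr A=\sup\{\operatorname{pd}_{\mathscr A}A\mid A\in\mathscr A,\ \operatorname{pd}_{\mathscr A}A<\infty\}$.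 *)

(* Defs.v *)
From mathcomp Require Import all_boot all_order all_algebra.
From mathcomp Require Import all_classical all_reals ereal.

Set Implicit Arguments.
Unset Strict Implicit.
Unset Printing Implicit Defensive.

Import GRing.Theory.

Local Open Scope classical_set_scope.
Local Open Scope ring_scope.

Reserved Notation "g \oc f" (at level 40, left associativity).

Record preadditive : Type := Preadditive {
  obj :> Type;
  hom : obj -> obj -> zmodType;
  idm : forall X, hom X X;
  comp : forall X Y Z, hom Y Z -> hom X Y -> hom X Z;
  compA : forall W X Y Z (h : hom Y Z) (g : hom X Y) (f : hom W X),
    comp h (comp g f) = comp (comp h g) f;
  comp1m : forall X Y (f : hom X Y), comp (idm Y) f = f;
  compm1 : forall X Y (f : hom X Y), comp f (idm X) = f;
  compDl : forall X Y Z (g g' : hom Y Z) (f : hom X Y),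
    comp (g + g') f = comp g f + comp g' f;
  compDr : forall X Y Z (g : hom Y Z) (f f' : hom X Y),
    comp g (f + f') = comp g f + comp g f'
}.

Arguments hom {p} X Y.
Arguments idm {p} X.
Notation "g \oc f" := (comp g f).

Section Notions.
Variable C : preadditive.
Implicit Types X Y Z W : C.

(* The hom groups being inhabited by 0, this says that X is initial and
   terminal. *)
Definition is_zero X : Prop :=
  forall Y, (forall f : hom X Y, f = 0) /\ (forall f : hom Y X, f = 0).

Definition is_iso X Y (f : hom X Y) : Prop :=
  exists g : hom Y X, g \oc f = idm X /\ f \oc g = idm Y.

Definition isomorphic X Y : Prop := exists f : hom X Y, is_iso f.

Definition is_mono X Y (f : hom X Y) : Prop :=
  forall W (u v : hom W X), f \oc u = f \oc v -> u = v.

Definition is_epi X Y (f : hom X Y) : Prop :=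
  forall W (u v : hom Y W), u \oc f = v \oc f -> u = v.

Definition is_kernel X Y K (f : hom X Y) (k : hom K X) : Prop :=
  f \oc k = 0 /\
  forall W (u : hom W X), f \oc u = 0 -> exists! v : hom W K, k \oc v = u.

Definition is_cokernel X Y Q (f : hom X Y) (c : hom Y Q) : Prop :=
  c \oc f = 0 /\
  forall W (u : hom Y W), u \oc f = 0 -> exists! v : hom Q W, v \oc c = u.

Definition is_biproduct X Y S (i1 : hom X S) (i2 : hom Y S)
    (p1 : hom S X) (p2 : hom S Y) : Prop :=
  [/\ p1 \oc i1 = idm X, p2 \oc i2 = idm Y, p1 \oc i2 = 0, p2 \oc i1 = 0
    & i1 \oc p1 + i2 \oc p2 = idm S].

Record is_abelian : Prop := IsAbelian {
  has_zero : exists Z, is_zero Z;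
  has_biproducts : forall X Y,
    exists S (i1 : hom X S) (i2 : hom Y S) (p1 : hom S X) (p2 : hom S Y),
      is_biproduct i1 i2 p1 p2;
  has_kernels : forall X Y (f : hom X Y),
    exists K (k : hom K X), is_kernel f k;
  has_cokernels : forall X Y (f : hom X Y),
    exists Q (c : hom Y Q), is_cokernel f c;
  mono_normal : forall X Y (f : hom X Y), is_mono f ->
    exists Z (g : hom Y Z), is_kernel g f;
  epi_normal : forall X Y (f : hom X Y), is_epi f ->
    exists Z (g : hom Z X), is_cokernel g f
}.

Definition is_image X Y I (f : hom X Y) (m : hom I Y) : Prop :=
  exists Q (c : hom Y Q), is_cokernel f c /\ is_kernel c m.

Definition exact_at X Y Z (f : hom X Y) (g : hom Y Z) : Prop :=
  exists I (m : hom I Y), is_image f m /\ is_kernel g m.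

Definition is_projective P : Prop :=
  forall X Y (f : hom X Y) (g : hom P Y), is_epi f ->
    exists h : hom P X, f \oc h = g.

Definition is_injective J : Prop :=
  forall X Y (f : hom X Y) (g : hom X J), is_mono f ->
    exists h : hom Y J, h \oc f = g.

Definition enough_projectives : Prop :=
  forall X, exists P (f : hom P X), is_projective P /\ is_epi f.

Definition enough_injectives : Prop :=
  forall X, exists J (f : hom X J), is_injective J /\ is_mono f.

Definition is_proj_resolution X (P : nat -> C)
    (d : forall k, hom (P k.+1) (P k)) (a : hom (P 0%N) X) : Prop :=
  [/\ forall k, is_projective (P k), is_epi a, exact_at (d 0%N) a
    & forall k, exact_at (d k.+1) (d k)].

Definition has_proj_resolution X (n : nat) : Prop :=
  exists (P : nat -> C) (d : forall k, hom (P k.+1) (P k)) (a : hom (P 0%N) X),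
    is_proj_resolution d a /\ forall k, (n < k)%N -> is_zero (P k).

End Notions.

(* Homological dimensions take their values in {0, 1, 2, ...} together with
   +oo, seen inside \bar R; in particular the zero object has dimension 0. *)
Definition pd (R : realType) (C : preadditive) (X : C) : \bar R :=
  ereal_inf [set n%:R%:E | n in [set n | has_proj_resolution X n]].

Definition Findim (R : realType) (C : preadditive) : \bar R :=
  ereal_sup [set pd R X | X in [set X : C | (pd R X < +oo)%E]].

Record abelian_category : Type := AbelianCategory {
  abelian_preadditive :> preadditive;
  abelianP : is_abelian abelian_preadditive
}.

(* Additivity is not required: the functors of a recollement have an adjoint,
   hence are additive. *)
Record functor (C D : preadditive) : Type := Functor {
  fobj :> C -> D;
  fmap : forall X Y : C, hom X Y -> hom (fobj X) (fobj Y);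
  fmap1 : forall X, fmap (idm X) = idm (fobj X);
  fmap_comp : forall X Y Z (g : hom Y Z) (f : hom X Y),
    fmap (g \oc f) = fmap g \oc fmap f
}.

Arguments fmap {C D} f {X Y} _ : rename.

Definition fully_faithful (C D : preadditive) (F : functor C D) : Prop :=
  forall X Y : C, bijective (fun f : hom X Y => fmap F f).

(* F is left adjoint to G *)
Record adjunction (C D : preadditive) (F : functor C D) (G : functor D C) :
    Type := Adjunction {
  adj : forall (X : C) (Y : D), hom (F X) Y -> hom X (G Y);
  adj_bij : forall X Y, bijective (@adj X Y);
  adj_natural : forall (X X' : C) (Y Y' : D)
      (h : hom X' X) (f : hom (F X) Y) (g : hom Y Y'),
    adj (g \oc f \oc fmap F h) = fmap G g \oc adj f \oc h
}.

Record recollement (A B C : abelian_category) : Type := Recollement {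
  rec_i : functor A B;
  rec_e : functor B C;
  rec_q : functor B A;
  rec_p : functor B A;
  rec_l : functor C B;
  rec_r : functor C B;
  rec_adj_le : adjunction rec_l rec_e;
  rec_adj_er : adjunction rec_e rec_r;
  rec_adj_qi : adjunction rec_q rec_i;
  rec_adj_ip : adjunction rec_i rec_p;
  rec_i_ff : fully_faithful rec_i;
  rec_l_ff : fully_faithful rec_l;
  rec_r_ff : fully_faithful rec_r;
  rec_ker : forall X : B,
    (exists Y : A, isomorphic (rec_i Y) X) <-> is_zero (rec_e X)
}.

Definition pgldim (R : realType) (A B C : abelian_category)
    (rec : recollement A B C) : \bar R :=
  ereal_sup [set pd R (rec_i rec X) | X in [set: A]].

(* Main.v *)
Require Import Defs.
From mathcomp Require Import all_boot all_order all_algebra.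
From mathcomp Require Import all_classical all_reals ereal.

(* Since Hom(i A, r C) = 0 and pd i A <= 1, the functor r is exact: the cokernel
   of r applied to an epimorphism lies in Ker e, and its length 1 resolution
   forces it to vanish.  So the exact functor e preserves projectives and
   pd e B <= pd B.
   If e B is projective, then l e B is projective and l e B -> B has kernel and
   cokernel in the image of i, both of projective dimension at most 1, so
   pd B <= 2; dimension shifting along a projective presentation of B gives
   pd B <= pd e B + 2 in general.  Applied to B = l C, where e l C = C, this shows
   that pd l C is finite when pd C is, while pd C <= pd l C.
   Finally q maps a resolution of i A of length at most 1 to a resolution of A,
   so pd A <= pd i A <= 1. *)

Set Implicit Arguments.
Unset Strict Implicit.
Unset Printing Implicit Defensive.

Import Order.TTheory GRing.Theory Num.Theory Defs.
Local Open Scope ring_scope.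

(** * Kernels, cokernels and biproducts in a preadditive category *)

Section Preadditive.
Variable C : preadditive.
Implicit Types X Y Z W S : C.

Lemma comp0m X Y Z (f : hom X Y) : (0 : hom Y Z) \oc f = 0.
Proof. by apply: (@addIr _ (0 \oc f)); rewrite -compDl !add0r. Qed.

Lemma compm0 X Y Z (g : hom Y Z) : g \oc (0 : hom X Y) = 0.
Proof. by apply: (@addIr _ (g \oc 0)); rewrite -compDr !add0r. Qed.

Lemma compNl X Y Z (g : hom Y Z) (f : hom X Y) : (- g) \oc f = - (g \oc f).
Proof. by apply: (@addIr _ (g \oc f)); rewrite -compDl !addNr comp0m. Qed.

Lemma compNr X Y Z (g : hom Y Z) (f : hom X Y) : g \oc (- f) = - (g \oc f).
Proof. by apply: (@addIr _ (g \oc f)); rewrite -compDr !addNr compm0. Qed.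

Lemma compBl X Y Z (g g' : hom Y Z) (f : hom X Y) :
  (g - g') \oc f = g \oc f - g' \oc f.
Proof. by rewrite compDl compNl. Qed.

Lemma compBr X Y Z (g : hom Y Z) (f f' : hom X Y) :
  g \oc (f - f') = g \oc f - g \oc f'.
Proof. by rewrite compDr compNr. Qed.

Lemma is_mono0 X Y (f : hom X Y) :
  (forall W (u : hom W X), f \oc u = 0 -> u = 0) -> is_mono f.
Proof.
move=> f0 W u v fuv; apply/eqP; rewrite -subr_eq0; apply/eqP/f0.
by rewrite compBr fuv subrr.
Qed.

Lemma mono0 X Y W (f : hom X Y) (u : hom W X) : is_mono f -> f \oc u = 0 -> u = 0.
Proof. by move=> fm fu; apply: fm; rewrite fu compm0. Qed.

Lemma is_epi0 X Y (f : hom X Y) :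
  (forall W (u : hom Y W), u \oc f = 0 -> u = 0) -> is_epi f.
Proof.
move=> f0 W u v fuv; apply/eqP; rewrite -subr_eq0; apply/eqP/f0.
by rewrite compBl fuv subrr.
Qed.

Lemma epi0 X Y W (f : hom X Y) (u : hom Y W) : is_epi f -> u \oc f = 0 -> u = 0.
Proof. by move=> fe fu; apply: fe; rewrite fu comp0m. Qed.

Lemma is_kernelI X Y K (f : hom X Y) (k : hom K X) :
  f \oc k = 0 -> is_mono k ->
  (forall W (u : hom W X), f \oc u = 0 -> exists v, k \oc v = u) ->
  is_kernel f k.
Proof.
move=> fk km kf; split=> // W u /kf [v <-]; exists v; split=> // v' /esym.
exact: km.
Qed.

Lemma kernel_mono X Y K (f : hom X Y) (k : hom K X) : is_kernel f k -> is_mono k.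
Proof.
move=> [fk kf]; apply: is_mono0 => W u ku.
have [v [_ vuniq]] := kf W 0 (compm0 _ _).
by rewrite -(vuniq u ku) (vuniq 0 (compm0 _ _)).
Qed.

Lemma kernel_lift X Y K W (f : hom X Y) (k : hom K X) (u : hom W X) :
  is_kernel f k -> f \oc u = 0 -> exists v, k \oc v = u.
Proof. by move=> [_ kf] /kf [v [? _]]; exists v. Qed.

Lemma cokernel_epi X Y Q (f : hom X Y) (c : hom Y Q) : is_cokernel f c -> is_epi c.
Proof.
move=> [cf fc]; apply: is_epi0 => W u uc.
have [v [_ vuniq]] := fc W 0 (comp0m _ _).
by rewrite -(vuniq u uc) (vuniq 0 (comp0m _ _)).
Qed.

Lemma cokernel_desc X Y Q W (f : hom X Y) (c : hom Y Q) (u : hom Y W) :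
  is_cokernel f c -> u \oc f = 0 -> exists v, v \oc c = u.
Proof. by move=> [_ fc] /fc [v [? _]]; exists v. Qed.

Lemma kernel_comp_mono X Y Z K (m : hom Y Z) (f : hom X Y) (k : hom K X) :
  is_mono m -> (is_kernel (m \oc f) k <-> is_kernel f k).
Proof.
move=> mm; split=> kk; apply: is_kernelI (kernel_mono kk) _.
- by apply: (mono0 mm); rewrite compA (proj1 kk).
- by move=> W u fu; apply: (kernel_lift kk); rewrite -compA fu compm0.
- by rewrite -compA (proj1 kk) compm0.
- by move=> W u; rewrite -compA => /(mono0 mm) /(kernel_lift kk).
Qed.

Lemma is_zero_id X : idm X = 0 -> is_zero X.
Proof.
move=> X0 Y; split=> f; first by rewrite -(compm1 f) X0 compm0.
by rewrite -(comp1m f) X0 comp0m.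
Qed.

Lemma comp_zero X Y Z (g : hom Y Z) (f : hom X Y) : is_zero Y -> g \oc f = 0.
Proof. by move=> Y0; rewrite (proj2 (Y0 X) f) compm0. Qed.

Lemma is_projective_iso X Y : isomorphic X Y -> is_projective X -> is_projective Y.
Proof.
move=> [f [g [_ fg]]] Xp U V h y he; have [x hx] := Xp U V h (y \oc f) he.
by exists (x \oc g); rewrite compA hx -compA fg compm1.
Qed.

Section Biproduct.
Variables (X Y S : C) (i1 : hom X S) (i2 : hom Y S) (p1 : hom S X) (p2 : hom S Y).
Hypothesis bip : is_biproduct i1 i2 p1 p2.

Lemma biproduct_expand W (u : hom W S) : u = i1 \oc (p1 \oc u) + i2 \oc (p2 \oc u).
Proof. by case: bip => _ _ _ _ e; rewrite !compA -compDl e comp1m. Qed.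

Lemma biproduct_proj1 W (x : hom W X) (y : hom W Y) :
  p1 \oc (i1 \oc x + i2 \oc y) = x.
Proof.
by case: bip => e1 _ e2 _ _; rewrite compDr !compA e1 e2 comp1m comp0m addr0.
Qed.

Lemma biproduct_proj2 W (x : hom W X) (y : hom W Y) :
  p2 \oc (i1 \oc x + i2 \oc y) = y.
Proof.
by case: bip => _ e1 _ e2 _; rewrite compDr !compA e1 e2 comp1m comp0m add0r.
Qed.

Lemma biproduct_inj1 W (f : hom X W) (g : hom Y W) :
  (f \oc p1 + g \oc p2) \oc i1 = f.
Proof.
by case: bip => e1 _ _ e2 _; rewrite compDl -!compA e1 e2 compm1 compm0 addr0.
Qed.

Lemma biproduct_inj2 W (f : hom X W) (g : hom Y W) :
  (f \oc p1 + g \oc p2) \oc i2 = g.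
Proof.
by case: bip => _ e1 e2 _ _; rewrite compDl -!compA e1 e2 compm1 compm0 add0r.
Qed.

Lemma biproduct_ext W (u v : hom W S) :
  p1 \oc u = p1 \oc v -> p2 \oc u = p2 \oc v -> u = v.
Proof. by move=> e1 e2; rewrite (biproduct_expand u) e1 e2 -biproduct_expand. Qed.

Lemma biproduct_projective : is_projective X -> is_projective Y -> is_projective S.
Proof.
move=> Xp Yp U V f g fe.
have [x fx] := Xp U V f (g \oc i1) fe; have [y fy] := Yp U V f (g \oc i2) fe.
exists (x \oc p1 + y \oc p2); rewrite compDr !compA fx fy -!compA -compDr.
by case: bip => _ _ _ _ ->; rewrite compm1.
Qed.

End Biproduct.

Definition is_ses K P X (k : hom K P) (f : hom P X) : Prop :=
  is_kernel f k /\ is_epi f.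

(** Projective dimension at most [n], by recursion on a first syzygy. Only some presentation is
    asked for; [schanuel] makes the choice immaterial. *)
Fixpoint pdle (n : nat) X : Prop :=
  if n is n'.+1 then
    exists K P (k : hom K P) (f : hom P X),
      [/\ is_ses k f, is_projective P & pdle n' K]
  else is_projective X.

Lemma pdle_iso n X Y : isomorphic X Y -> pdle n X -> pdle n Y.
Proof.
case: n => [|n] XY; first exact: is_projective_iso.
case: XY => g [g' [g'g gg']] [K [P [k [f [[kf fe] Pp Kn]]]]].
exists K, P, k, (g \oc f); split=> //; split.
  apply/kernel_comp_mono => // W u v guv.
  by rewrite -(comp1m u) -g'g -compA guv compA g'g comp1m.
move=> W u v; rewrite !compA => /fe uv.
by rewrite -(compm1 u) -gg' compA uv -compA gg' compm1.
Qed.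

End Preadditive.

(** * Images, resolutions and Schanuel's lemma in an abelian category *)

Section Abelian.
Variable C : abelian_category.
Implicit Types X Y Z W S : C.

Lemma mono_kernel_cokernel X Y Q (f : hom X Y) (c : hom Y Q) :
  is_mono f -> is_cokernel f c -> is_kernel c f.
Proof.
move=> fm fc; have [Z [g gf]] := mono_normal (abelianP C) fm.
apply: is_kernelI fm _ => [|W u cu]; first by case: fc.
have [g' g'c] := cokernel_desc fc (proj1 gf).
by apply: (kernel_lift gf); rewrite -g'c -compA cu compm0.
Qed.

Lemma epi_desc X Y K W (f : hom X Y) (k : hom K X) (u : hom X W) :
  is_epi f -> is_kernel f k -> u \oc k = 0 -> exists v, v \oc f = u.
Proof.
move=> fe kf uk; have [Z [g gf]] := epi_normal (abelianP C) fe.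
have [g' kg'] := kernel_lift kf (proj1 gf).
by apply: (cokernel_desc gf); rewrite -kg' compA uk comp0m.
Qed.

(** If [u] kills [f'], then [f] factors through the subobject [m n], where [n] is the kernel of [u].
    This subobject is the kernel of some [g]; as [g] kills [f] it factors through [c], so it kills
    [m]. Hence [n] splits and [u = 0]. *)
Lemma image_epi X Y Q I (f : hom X Y) (c : hom Y Q) (m : hom I Y) (f' : hom X I) :
  is_cokernel f c -> is_kernel c m -> m \oc f' = f -> is_epi f'.
Proof.
move=> fc cm mf; apply: is_epi0 => W u uf'.
have mm := kernel_mono cm.
have [N [n nu]] := has_kernels (abelianP C) u.
have [f'' nf''] := kernel_lift nu uf'.
have mnm : is_mono (m \oc n).
  by move=> V x y; rewrite -!compA => /mm /(kernel_mono nu).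
have [Z [g gmn]] := mono_normal (abelianP C) mnm.
have gf : g \oc f = 0 by rewrite -mf -nf'' (compA m) compA (proj1 gmn) comp0m.
have [g' g'c] := cokernel_desc fc gf.
have gm : g \oc m = 0 by rewrite -g'c -compA (proj1 cm) compm0.
have [s] := kernel_lift gmn gm; rewrite -compA -{2}(compm1 m) => /mm ns.
by rewrite -(compm1 u) -ns compA (proj1 nu) comp0m.
Qed.

Lemma cokernel_projective_lift X Y Q P (f : hom X Y) (c : hom Y Q) (u : hom P Y) :
  is_projective P -> is_cokernel f c -> c \oc u = 0 -> exists v, f \oc v = u.
Proof.
move=> Pp fc cu; have [I [m cm]] := has_kernels (abelianP C) c.
have [f' mf'] := kernel_lift cm (proj1 fc); have [u' mu'] := kernel_lift cm cu.
have [v f'v] := Pp _ _ _ u' (image_epi fc cm mf').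
by exists v; rewrite -mf' -compA f'v.
Qed.

Lemma exact_atE X Y Z (f : hom X Y) (g : hom Y Z) : exact_at f g ->
  exists I (m : hom I Y) (f' : hom X I),
    [/\ is_kernel g m, is_epi f' & f = m \oc f'].
Proof.
move=> [I [m [[Q [c [fc cm]]] gm]]]; have [f' mf'] := kernel_lift cm (proj1 fc).
by exists I, m, f'; split=> //; apply: image_epi fc cm mf'.
Qed.

Lemma exact_atI X Y Z I (m : hom I Y) (f : hom X I) (g : hom Y Z) :
  is_kernel g m -> is_epi f -> exact_at (m \oc f) g.
Proof.
move=> gm fe; exists I, m; split=> //.
have [Q [c mc]] := has_cokernels (abelianP C) m.
exists Q, c; split; last exact: mono_kernel_cokernel (kernel_mono gm) mc.
split=> [|W u]; first by rewrite compA (proj1 mc) comp0m.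
by rewrite compA => /(epi0 fe); apply: (proj2 mc).
Qed.

Lemma exact_at_comp_mono W X Y Z (m : hom Y Z) (g : hom X Y) (f : hom W X) :
  is_mono m -> (exact_at f (m \oc g) <-> exact_at f g).
Proof.
move=> mm; split=> -[I [n [fn gn]]]; exists I, n; split=> //.
  exact: (proj1 (kernel_comp_mono _ _ mm)).
exact: (proj2 (kernel_comp_mono _ _ mm)).
Qed.

(** A resolution is cut at the image of [d 0], the rest resolving the first syzygy; conversely, a
    presentation is spliced with a resolution of its kernel. *)
Lemma has_proj_resolution_pdle n X : has_proj_resolution X n <-> pdle n X.
Proof.
elim: n X => [|n IH] X; split.
- move=> [P [d [a [[Pp ae da _] P0]]]].
  have [I [m [d' [am d'e _]]]] := exact_atE da.
  (* Since [P 1] is zero, [a] has zero kernel, so [X] is isomorphic to the projective [P 0]. *)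
  have m0 : m = 0 by apply: (epi0 d'e); apply: (proj1 (P0 1%N isT _)).
  move=> U V f g fe; have [h fh] := Pp 0%N U V f (g \oc a) fe.
  have [h' h'a] : exists h', h' \oc a = h.
    by apply: (epi_desc ae am); rewrite m0 compm0.
  by exists h'; apply: ae; rewrite -compA h'a fh.
- move=> Xp; have [Z Z0] := has_zero (abelianP C).
  pose P k : C := if k is 0 then X else Z.
  pose d k : hom (P k.+1) (P k) := 0.
  exists P, d, (idm X); split; last by case.
  split.
  + by case=> // k U V f g _; exists 0; rewrite compm0 (proj1 (Z0 _) g).
  + by move=> W u v; rewrite !compm1.
  + have -> : d 0%N = (0 : hom Z X) \oc idm Z by rewrite comp0m.
    apply: exact_atI => [|W u v]; last by rewrite !compm1.
    apply: is_kernelI => [|W u v _|W u]; first by rewrite compm0.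
      by rewrite (proj2 (Z0 _) u) (proj2 (Z0 _) v).
    by rewrite comp1m => ->; exists 0; rewrite comp0m.
  + move=> k; have -> : d k.+1 = idm Z \oc idm Z.
      by rewrite (proj1 (Z0 _) (d k.+1)) (proj1 (Z0 _) (_ \oc _)).
    apply: exact_atI => [|W u v]; last by rewrite !compm1.
    apply: is_kernelI => [|W u v|W u _]; first by rewrite comp0m.
      by rewrite !comp1m.
    by exists u; rewrite comp1m.
- move=> [P [d [a [[Pp ae da dd] P0]]]].
  have [I [m [d' [am d'e d0]]]] := exact_atE da.
  exists I, (P 0%N), m, a; split=> //; apply/IH.
  exists (fun k => P k.+1), (fun k => d k.+1), d'.
  split; last by move=> k kn; apply: P0.
  split=> [k|//||k]; [exact: Pp| |exact: dd].
  by have := dd 0%N; rewrite d0 => /exact_at_comp_mono; apply; apply: kernel_mono am.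
- move=> [K [P [k [f [[kf fe] Pp /IH[Q [d [a [[Qp ae da dd] Q0]]]]]]]]].
  pose P' j : C := if j is j'.+1 then Q j' else P.
  pose d' j : hom (P' j.+1) (P' j) :=
    match j return hom (P' j.+1) (P' j) with 0 => k \oc a | j'.+1 => d j' end.
  exists P', d', f; split; last by case=> // j; apply: Q0.
  split=> //; first by case.
    exact: exact_atI.
  case=> [|j]; last exact: dd.
  by apply/exact_at_comp_mono => //; apply: kernel_mono kf.
Qed.

(** Adding [P] to the middle term of a presentation of [X] leaves the kernel [K] unchanged. *)
Lemma pdle_biproduct n X P S (i1 : hom X S) (i2 : hom P S) (p1 : hom S X)
    (p2 : hom S P) :
  is_biproduct i1 i2 p1 p2 -> is_projective P -> pdle n X -> pdle n S.
Proof.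
move=> bS Pp; case: n => [|n]; first by move=> Xp; apply: biproduct_projective bS _ _.
move=> [K [Q [k [f [[kf fe] Qp Kn]]]]].
have [T [j1 [j2 [q1 [q2 bT]]]]] := has_biproducts (abelianP C) Q P.
pose F := i1 \oc (f \oc q1) + i2 \oc q2.
have F1 : p1 \oc F = f \oc q1 by rewrite (biproduct_proj1 bS).
have F2 : p2 \oc F = q2 by rewrite (biproduct_proj2 bS).
have [q1j1 _ _ q2j1 _] := bT.
exists K, T, (j1 \oc k), F; split=> //; last exact: biproduct_projective bT _ _.
split.
  apply: is_kernelI => [||W u Fu].
  - rewrite compDl -!compA !(compA _ j1) q1j1 q2j1 comp1m comp0m (proj1 kf).
    by rewrite !compm0 addr0.
  - move=> W u v e; apply: (kernel_mono kf).
    by rewrite -(comp1m (k \oc u)) -(comp1m (k \oc v)) -q1j1 -!compA (compA j1) e -compA.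
  - have q2u : q2 \oc u = 0 by rewrite -F2 -compA Fu compm0.
    have fu : f \oc (q1 \oc u) = 0 by rewrite compA -F1 -compA Fu compm0.
    have [v kv] := kernel_lift kf fu; exists v.
    by rewrite (biproduct_expand bT u) q2u compm0 addr0 -compA kv.
have FE W (u : hom S W) : u \oc F = u \oc i1 \oc f \oc q1 + u \oc i2 \oc q2.
  by rewrite compDr !compA.
apply: is_epi0 => W u uF.
have u1 : u \oc i1 = 0.
  by apply: (epi0 fe); rewrite -(biproduct_inj1 bT (u \oc i1 \oc f) (u \oc i2)) -FE uF comp0m.
have u2 : u \oc i2 = 0.
  by rewrite -(biproduct_inj2 bT (u \oc i1 \oc f) (u \oc i2)) -FE uF comp0m.
have [_ _ _ _ eS] := bS.
by rewrite -(compm1 u) -eS compDr !compA u1 u2 !comp0m addr0.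
Qed.

(* Schanuel: comparing two projective presentations of X gives maps with
   1 = al be - h k' on K', so that K + P' maps onto K' with kernel P. *)
Lemma schanuel n X K P K' P' (k : hom K P) (f : hom P X) (k' : hom K' P')
    (f' : hom P' X) :
  is_projective P -> is_projective P' -> is_ses k f -> is_ses k' f' ->
  pdle n K -> pdle n K'.
Proof.
move=> Pp P'p [kf fe] [kf' fe'].
have [a f'a] := Pp _ _ _ f fe'; have [b fb] := P'p _ _ _ f' fe.
have km := kernel_mono kf; have km' := kernel_mono kf'.
have [al k'al] : exists al, k' \oc al = a \oc k.
  by apply: (kernel_lift kf'); rewrite compA f'a (proj1 kf).
have [be kbe] : exists be, k \oc be = b \oc k'.
  by apply: (kernel_lift kf); rewrite compA fb (proj1 kf').
have [h k'h] : exists h, k' \oc h = a \oc b - idm P'.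
  by apply: (kernel_lift kf'); rewrite compBr compA f'a fb compm1 subrr.
have [g kg] : exists g, k \oc g = idm P - b \oc a.
  by apply: (kernel_lift kf); rewrite compBr compA fb f'a compm1 subrr.
have split_id : al \oc be - h \oc k' = idm K'.
  apply: km'; rewrite compBr !compA k'al k'h -compA kbe compA compBl comp1m.
  by rewrite opprB addrC subrK compm1.
(* [gen] and [gen'] identify the kernel of [(al, h)] from K + P' to K' with [P], embedded by
   [(g, a)]. *)
have gen W (x : hom W K) (y : hom W P') : al \oc x + h \oc y = 0 ->
    let p := k \oc x + b \oc y in x = g \oc p /\ y = a \oc p.
  move=> e p; have yap : y = a \oc p.
    have := congr1 (fun z => k' \oc z) e.
    rewrite compDr !compA k'al k'h compm0 compBl comp1m addrA => /eqP.
    by rewrite subr_eq0 => /eqP <-; rewrite /p compDr !compA.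
  split=> //; apply: km; rewrite compA kg compBl comp1m -compA -yap.
  by rewrite /p addrK.
have gen' : al \oc g + h \oc a = 0.
  apply: (mono0 km'); rewrite compDr !compA k'al k'h -compA kg compBr compm1.
  by rewrite compBl comp1m !compA addrA subrK subrr.
(* For [n = 0], [split_id] makes [K'] a retract of K + P', which is projective. *)
case: n => [Kp|n [M [Q [m [rho [[mrho rhoe] Qp Mn]]]]]].
  move=> U V w y we.
  have [s ws] := Kp _ _ _ (y \oc al) we; have [t wt] := P'p _ _ _ (y \oc h) we.
  exists (s \oc be - t \oc k').
  by rewrite compBr !compA ws wt -!compA -compBr split_id compm1.
(* Replacing [K] by its projective cover [Q] turns the kernel [P] into an extension of [P] by [M],
   which the lift [ga] of [g] splits: the new kernel is M + P. *)
have [ga rhoga] := Pp _ _ _ g rhoe.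
have [T [j1 [j2 [q1 [q2 bT]]]]] := has_biproducts (abelianP C) Q P'.
have [N [i1 [i2 [p1 [p2 bN]]]]] := has_biproducts (abelianP C) M P.
pose F := (al \oc rho) \oc q1 + h \oc q2.
pose G := j1 \oc (m \oc p1 + ga \oc p2) + j2 \oc (a \oc p2).
have G1 : q1 \oc G = m \oc p1 + ga \oc p2 by rewrite (biproduct_proj1 bT).
have G2 : q2 \oc G = a \oc p2 by rewrite (biproduct_proj2 bT).
have mm := kernel_mono mrho.
have kgba : k \oc g + b \oc a = idm P by rewrite kg subrK.
have rhoG1 : rho \oc (q1 \oc G) = g \oc p2.
  by rewrite G1 compDr !compA (proj1 mrho) rhoga comp0m add0r.
exists N, T, G, F; split; [|exact: biproduct_projective bT _ _|]; last first.
  exact: pdle_biproduct bN Pp Mn.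
split.
  apply: is_kernelI.
  - by rewrite compDl -!compA G2 rhoG1 !compA -compDl gen' comp0m.
  - apply: is_mono0 => W u Gu.
    have p2u : p2 \oc u = 0.
      rewrite -(comp1m (p2 \oc u)) -kgba compDl -!compA (compA g) -rhoG1.
      by rewrite (compA a) -G2 -!compA Gu !compm0 addr0.
    apply: (biproduct_ext bN); rewrite compm0 //.
    apply: (mono0 mm); have : q1 \oc G \oc u = 0 by rewrite -compA Gu compm0.
    by rewrite G1 compDl -!compA p2u compm0 addr0.
  - move=> W u Fu.
    have e : al \oc (rho \oc (q1 \oc u)) + h \oc (q2 \oc u) = 0.
      by rewrite !compA -compDl.
    have /= := gen _ _ _ e; set p := _ + _ => -[ex ey].
    have [x mx] : exists x, m \oc x = q1 \oc u - ga \oc p.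
      by apply: (kernel_lift mrho); rewrite compBr ex (compA rho ga) rhoga subrr.
    exists (i1 \oc x + i2 \oc p); apply: (biproduct_ext bT); rewrite compA.
      rewrite G1 compDl -!compA (biproduct_proj1 bN) (biproduct_proj2 bN) mx.
      by rewrite subrK.
    by rewrite G2 -compA (biproduct_proj2 bN) ey.
apply: is_epi0 => W u uF.
have u1 : u \oc al = 0.
  apply: (epi0 rhoe); rewrite -compA -(biproduct_inj1 bT (al \oc rho) h).
  by rewrite compA uF comp0m.
have u2 : u \oc h = 0.
  by rewrite -(biproduct_inj2 bT (al \oc rho) h) compA uF comp0m.
by rewrite -(compm1 u) -split_id compBr !compA u1 u2 !comp0m subrr.
Qed.

Lemma pdle_syzygy n X K P (k : hom K P) (f : hom P X) :
  is_projective P -> is_ses k f -> pdle n.+1 X -> pdle n K.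
Proof. by move=> Pp kf [K' [P' [k' [f' [kf' P'p Kn]]]]]; apply: schanuel kf' kf Kn. Qed.

(* If u has projective source, then a presentation Q -> N with kernel L gives
   an epimorphism X + Q -> Y whose kernel is M + L. *)
Lemma pdle2_kernel_cokernel X Y M N (u : hom X Y) (m : hom M X) (c : hom Y N) :
  is_projective X -> is_kernel u m -> is_cokernel u c ->
  pdle 1 M -> pdle 1 N -> pdle 2 Y.
Proof.
move=> Xp um uc M1 [L [Q [l [pi [[lpi pie] Qp Lp]]]]].
have [t ct] := Qp _ _ _ pi (cokernel_epi uc).
(* Here [c t l = pi l = 0], so [t l] lifts through [u]; the sign puts [(s, l)] in the kernel of
   [F]. *)
have [s us] : exists s, u \oc s = - (t \oc l).
  apply: (cokernel_projective_lift Lp uc).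
  by rewrite compNr compA ct (proj1 lpi) oppr0.
have [T [j1 [j2 [q1 [q2 bT]]]]] := has_biproducts (abelianP C) X Q.
have [S [i1 [i2 [p1 [p2 bS]]]]] := has_biproducts (abelianP C) M L.
pose F := u \oc q1 + t \oc q2.
pose G := j1 \oc (m \oc p1 + s \oc p2) + j2 \oc (l \oc p2).
have G1 : q1 \oc G = m \oc p1 + s \oc p2 by rewrite (biproduct_proj1 bT).
have G2 : q2 \oc G = l \oc p2 by rewrite (biproduct_proj2 bT).
have mm := kernel_mono um; have lm := kernel_mono lpi.
exists S, T, G, F; split; [|exact: biproduct_projective bT _ _|]; last first.
  exact: pdle_biproduct bS Lp M1.
split.
  apply: is_kernelI.
  - rewrite compDl -!compA G2 G1 compDr !compA (proj1 um) us comp0m add0r.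
    by rewrite compNl addNr.
  - apply: is_mono0 => W w Gw.
    have p2w : p2 \oc w = 0.
      by apply: (mono0 lm); rewrite compA -G2 -compA Gw compm0.
    apply: (biproduct_ext bS); rewrite compm0 //.
    apply: (mono0 mm); have : q1 \oc G \oc w = 0 by rewrite -compA Gw compm0.
    by rewrite G1 compDl -!compA p2w compm0 addr0.
  - move=> W w Fw.
    have e : u \oc (q1 \oc w) + t \oc (q2 \oc w) = 0 by rewrite !compA -compDl.
    have [z lz] : exists z, l \oc z = q2 \oc w.
      apply: (kernel_lift lpi); rewrite -ct -compA.
      have := congr1 (fun x => c \oc x) e.
      by rewrite compDr compm0 (compA c u) (proj1 uc) comp0m add0r.
    have [x mx] : exists x, m \oc x = q1 \oc w - s \oc z.
      apply: (kernel_lift um); rewrite compBr (compA u s) us compNl opprK -compA.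
      by rewrite lz.
    exists (i1 \oc x + i2 \oc z); apply: (biproduct_ext bT); rewrite compA.
      rewrite G1 compDl -!compA (biproduct_proj1 bS) (biproduct_proj2 bS) mx.
      by rewrite subrK.
    by rewrite G2 -compA (biproduct_proj2 bS) lz.
apply: is_epi0 => W w wF.
have w1 : w \oc u = 0 by rewrite -(biproduct_inj1 bT u t) compA wF comp0m.
have w2 : w \oc t = 0 by rewrite -(biproduct_inj2 bT u t) compA wF comp0m.
have [w' w'c] := cokernel_desc uc w1.
have w'0 : w' = 0 by apply: (epi0 pie); rewrite -ct compA w'c w2.
by rewrite -w'c w'0 comp0m.
Qed.

End Abelian.

(** * Exactness properties of adjoint functors *)

Section Adjunction.
Variables (C D : abelian_category) (F : functor C D) (G : functor D C).
Variable a : adjunction F G.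

Lemma adj_inj (X : C) (Y : D) (f g : hom (F X) Y) : adj a f = adj a g -> f = g.
Proof. exact: (bij_inj (adj_bij a X Y)). Qed.

Lemma adj_surj (X : C) (Y : D) (u : hom X (G Y)) : exists f, adj a f = u.
Proof. by have [g _ gK] := adj_bij a X Y; exists (g u). Qed.

Lemma adj_compl (X' X : C) (Y : D) (f : hom (F X) Y) (h : hom X' X) :
  adj a (f \oc fmap F h) = adj a f \oc h.
Proof. by have := adj_natural a h f (idm Y); rewrite fmap1 !comp1m. Qed.

Lemma adj_compr (X : C) (Y Y' : D) (f : hom (F X) Y) (g : hom Y Y') :
  adj a (g \oc f) = fmap G g \oc adj a f.
Proof. by have := adj_natural a (idm X) f g; rewrite fmap1 !compm1. Qed.

(** The adjunction is given as a bijection, not as a group isomorphism: [hom (F X) (F X)] has one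
    element because [hom X (G (F X))] has. *)
Lemma ladj_zero (X : C) : is_zero X -> is_zero (F X).
Proof.
move=> X0; apply: is_zero_id; apply: adj_inj.
by rewrite (proj1 (X0 _) (adj a 0)) (proj1 (X0 _) (adj a _)).
Qed.

Lemma radj_zero (Y : D) : is_zero Y -> is_zero (G Y).
Proof.
move=> Y0; apply: is_zero_id.
have [f <-] := adj_surj (idm (G Y)); have [g <-] := adj_surj (0 : hom (G Y) (G Y)).
by rewrite (proj2 (Y0 _) f) (proj2 (Y0 _) g).
Qed.

(** A zero map factors through a zero object, which [F] preserves. *)
Lemma ladj_fmap0 (X Y : C) : fmap F (0 : hom X Y) = 0.
Proof.
have [Z Z0] := has_zero (abelianP C).
by rewrite -(comp0m _ (0 : hom X Z)) fmap_comp comp_zero //; apply: ladj_zero.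
Qed.

Lemma radj_fmap0 (X Y : D) : fmap G (0 : hom X Y) = 0.
Proof.
have [Z Z0] := has_zero (abelianP D).
by rewrite -(comp0m _ (0 : hom X Z)) fmap_comp comp_zero //; apply: radj_zero.
Qed.

Lemma adj0 (X : C) (Y : D) : adj a (0 : hom (F X) Y) = 0.
Proof. by rewrite -(comp0m Y (0 : hom (F X) Y)) adj_compr radj_fmap0 comp0m. Qed.

Lemma adj_eq0 (X : C) (Y : D) (f : hom (F X) Y) : adj a f = 0 -> f = 0.
Proof. by move=> f0; apply: adj_inj; rewrite f0 adj0. Qed.

Lemma is_zero_ladj (X : C) :
  (forall (Y : D) (u : hom X (G Y)), u = 0) -> is_zero (F X).
Proof. by move=> X0; apply/is_zero_id/adj_eq0. Qed.

Lemma is_zero_radj (Y : D) :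
  (forall (X : C) (u : hom (F X) Y), u = 0) -> is_zero (G Y).
Proof.
move=> Y0; apply: is_zero_id; have [f <-] := adj_surj (idm (G Y)).
by rewrite (Y0 _ f) adj0.
Qed.

Lemma hom_radj_eq0 (X : C) (Y : D) (u : hom X (G Y)) : is_zero (F X) -> u = 0.
Proof.
by move=> FX0; have [f <-] := adj_surj u; rewrite (proj1 (FX0 Y) f) adj0.
Qed.

Lemma ladj_epi (X Y : C) (f : hom X Y) : is_epi f -> is_epi (fmap F f).
Proof.
move=> fe W u v uv; apply/adj_inj/fe.
by rewrite -!adj_compl uv.
Qed.

Lemma radj_mono (X Y : D) (f : hom X Y) : is_mono f -> is_mono (fmap G f).
Proof.
move=> fm W u v; have [u' <-] := adj_surj u; have [v' <-] := adj_surj v.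
by rewrite -!adj_compr => /adj_inj /fm ->.
Qed.

Lemma radj_kernel (X Y K : D) (f : hom X Y) (k : hom K X) :
  is_kernel f k -> is_kernel (fmap G f) (fmap G k).
Proof.
move=> kf; apply: is_kernelI.
- by rewrite -fmap_comp (proj1 kf) radj_fmap0.
- exact/radj_mono/kernel_mono/kf.
- move=> W u; have [u' <-] := adj_surj u; rewrite -adj_compr => /adj_eq0.
  by move=> /(kernel_lift kf) [v kv]; exists (adj a v); rewrite -adj_compr kv.
Qed.

(** Lifting a map out of [F X] along [f] amounts to lifting its adjunct out of [X] along [G f]. *)
Lemma ladj_projective (X : C) :
  (forall (Y Y' : D) (f : hom Y Y'), is_epi f -> is_epi (fmap G f)) ->
  is_projective X -> is_projective (F X).
Proof.
move=> Ge Xp U V f g fe; have [h fh] := Xp _ _ _ (adj a g) (Ge _ _ _ fe).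
have [h' h'h] := adj_surj h; exists h'; apply: adj_inj.
by rewrite adj_compr h'h.
Qed.

(* Full faithfulness makes composition with the unit bijective on hom groups. *)
Lemma unit_iso (X : C) : fully_faithful F -> isomorphic X (G (F X)).
Proof.
move=> Fff.
have unitE Y (f : hom Y X) : adj a (fmap F f) = adj a (idm (F X)) \oc f.
  by rewrite -adj_compl comp1m.
have [h1 hh1] := adj_surj (idm (G (F X))).
have [K KF FK] := Fff (G (F X)) X; have [K' KF' _] := Fff X X.
exists (adj a (idm (F X))), (K h1); split; last by rewrite -unitE FK hh1.
apply: (can_inj KF'); apply: adj_inj; rewrite !unitE compA -(unitE _ (K h1)) FK hh1.
by rewrite comp1m compm1.
Qed.

End Adjunction.

Section FullyFaithful.
Variables (C D : preadditive) (F : functor C D).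
Hypothesis Fff : fully_faithful F.

Lemma ff_inj (X Y : C) (f g : hom X Y) : fmap F f = fmap F g -> f = g.
Proof. by have [K KF _] := Fff X Y => fg; rewrite -(KF f) fg KF. Qed.

Lemma ff_surj (X Y : C) (u : hom (F X) (F Y)) : exists f, fmap F f = u.
Proof. by have [K _ FK] := Fff X Y; exists (K u). Qed.

End FullyFaithful.

(** * Recollements: the functors [i] and [q] *)

Section Recollement.
Variables (A B C : abelian_category) (rec : recollement A B C).
Notation i := (rec_i rec).
Notation e := (rec_e rec).
Notation q := (rec_q rec).
Notation l := (rec_l rec).
Notation r := (rec_r rec).
Notation le := (rec_adj_le rec).
Notation er := (rec_adj_er rec).
Notation qi := (rec_adj_qi rec).
Notation ip := (rec_adj_ip rec).

Lemma rec_ei_zero (X : A) : is_zero (e (i X)).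
Proof.
apply/(rec_ker rec); exists X; exists (idm (i X)), (idm (i X)).
by rewrite comp1m.
Qed.

Lemma hom_ir_eq0 (X : A) (Y : C) (u : hom (i X) (r Y)) : u = 0.
Proof. exact: hom_radj_eq0 er _ _ _ (rec_ei_zero X). Qed.

Lemma rec_e_ses (K P X : B) (k : hom K P) (f : hom P X) :
  is_ses k f -> is_ses (fmap e k) (fmap e f).
Proof.
move=> [kf fe]; split; first exact: radj_kernel le _ _ _ _ _ kf.
exact: ladj_epi er _ _ _ fe.
Qed.

(* The pushout of L -> Q along u is an extension of i X by i J, hence lies in
   the essential image of i, where the injectivity of J splits it. *)
Lemma hom_to_injective_extends (X J : A) (L Q : B) (k : hom L Q)
    (g : hom Q (i X)) (u : hom L (i J)) :
  is_injective J -> is_ses k g -> exists w : hom Q (i J), w \oc k = u.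
Proof.
move=> Jinj [kg ge].
have km := kernel_mono kg.
have [S [i1 [i2 [p1 [p2 bS]]]]] := has_biproducts (abelianP B) Q (i J).
pose phi := i1 \oc k + i2 \oc (- u).
have phi1 : p1 \oc phi = k by rewrite (biproduct_proj1 bS).
have phim : is_mono phi.
  by move=> W x y exy; apply: km; rewrite -phi1 -!compA exy.
have [E [c phic]] := has_cokernels (abelianP B) phi.
have cphi : c \oc i1 \oc k = c \oc i2 \oc u.
  apply/eqP; rewrite -subr_eq0 -!compA -compBr -compNr.
  by apply/eqP; case: phic.
(* A map from [E] to an object [r W] vanishes on [i J]; its restriction to [Q] then kills [k], so
   factors through [i X] and vanishes too. *)
have eE0 : is_zero (e E).
  apply: (is_zero_ladj er) => W v; apply: (epi0 (cokernel_epi phic)).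
  have vc2 : v \oc (c \oc i2) = 0 by apply: hom_ir_eq0.
  have vc1 : v \oc (c \oc i1) = 0.
    have [v' <-] : exists v', v' \oc g = v \oc (c \oc i1).
      by apply: (epi_desc ge kg); rewrite -compA cphi compA vc2 comp0m.
    by rewrite (hom_ir_eq0 v') comp0m.
  have [_ _ _ _ eS] := bS.
  rewrite -(compm1 (v \oc c)) -eS compDr !compA -(compA v c i1) -(compA v c i2).
  by rewrite vc1 vc2 !comp0m addr0.
have [E' [th [th' [_ thth']]]] := proj2 (rec_ker rec E) eE0.
have [j ij] := ff_surj (@rec_i_ff _ _ _ rec) (th' \oc (c \oc i2)).
(* If [j x = 0], then [i2 (i x)] factors through [phi], the kernel of [c]; comparing first
   components shows that the factor [y] is zero. *)
have jm : is_mono j.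
  apply: is_mono0 => W x jx.
  have cx : c \oc (i2 \oc fmap i x) = 0.
    rewrite -(comp1m (c \oc _)) -thth' -compA (compA c) (compA th') -ij.
    by rewrite -fmap_comp jx (ladj_fmap0 ip) compm0.
  have [y phiy] := kernel_lift (mono_kernel_cokernel phim phic) cx.
  have [_ p22 p12 _ _] := bS.
  have y0 : y = 0.
    by apply: (mono0 km); rewrite -phi1 -compA phiy compA p12 comp0m.
  apply: (ff_inj (@rec_i_ff _ _ _ rec)); rewrite (ladj_fmap0 ip).
  by rewrite -(comp1m (fmap i x)) -p22 -compA -phiy y0 !compm0.
have [rho rhoj] := Jinj _ _ _ (idm J) jm.
exists (fmap i rho \oc (th' \oc (c \oc i1))).
rewrite -!compA (compA c) cphi (compA th') -ij.
by rewrite compA -fmap_comp rhoj fmap1 comp1m.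
Qed.

(** Embed [q L] into an injective [J]. The adjunct map from [L] to [i J] extends to [Q], so the
    embedding factors through [q k]. *)
Lemma rec_q_mono (injA : enough_injectives A) (X : A) (L Q : B) (k : hom L Q)
    (g : hom Q (i X)) : is_ses k g -> is_mono (fmap q k).
Proof.
move=> kg; have [J [u [Jinj um]]] := injA (q L).
have [w wk] := hom_to_injective_extends (adj qi u) Jinj kg.
have [w' w'w] := adj_surj qi w.
have w'k : w' \oc fmap q k = u.
  by apply: (adj_inj (a := qi)); rewrite adj_compl w'w.
by move=> W x y kxy; apply: um; rewrite -w'k -!compA kxy.
Qed.

Lemma rec_i_projective (X : A) : is_projective (i X) -> is_projective X.
Proof.
move=> Xp U V f g fe; have [h fh] := Xp _ _ _ (fmap i g) (ladj_epi ip fe).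
have [h' h'h] := ff_surj (@rec_i_ff _ _ _ rec) h.
by exists h'; apply: (ff_inj (@rec_i_ff _ _ _ rec)); rewrite fmap_comp h'h.
Qed.

Lemma rec_q_projective (X : B) : is_projective X -> is_projective (q X).
Proof. by apply: (ladj_projective qi) => Y Y' f; apply: (ladj_epi ip). Qed.

Lemma rec_l_projective (X : C) : is_projective X -> is_projective (l X).
Proof. by apply: (ladj_projective le) => Y Y' f; apply: (ladj_epi er). Qed.

(** As a left adjoint [q] is right exact, and [q i] is the identity up to isomorphism, so a
    presentation of [i X] goes to one of [X] once [q k] is mono. The kernel [L] need not lie in the
    image of [i], so the argument covers a single step. *)
Lemma pdle_rec_i (injA : enough_injectives A) n (X : A) :
  (n <= 1)%N -> pdle n (i X) -> pdle n X.
Proof.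
case: n => [|[|//]] _; first exact: rec_i_projective.
move=> [L [Q [k [g [kg Qp Lp]]]]].
have [g' g'g] := adj_surj qi g.
exists (q L), (q Q), (fmap q k), g'; split; try exact: rec_q_projective.
have g'e : is_epi g'.
  move=> W u v uv; apply: (ff_inj (@rec_i_ff _ _ _ rec)); apply: (proj2 kg).
  by rewrite -g'g -!adj_compr uv.
split=> //; apply: mono_kernel_cokernel (rec_q_mono injA kg) _.
have g'k : g' \oc fmap q k = 0.
  by apply: (adj_eq0 (a := qi)); rewrite adj_compl g'g (proj1 (proj1 kg)).
split=> // W w wk.
have [v vg] : exists v, v \oc g = adj qi w.
  by apply: (epi_desc (proj2 kg) (proj1 kg)); rewrite -adj_compl wk adj0.
have [v' v'v] := ff_surj (@rec_i_ff _ _ _ rec) v.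
have v'g' : v' \oc g' = w.
  by apply: (adj_inj (a := qi)); rewrite adj_compr v'v g'g.
by exists v'; split=> // z zg'; apply: g'e; rewrite zg'.
Qed.

(** * The functors [r], [e] and [l] under relative global dimension at most 1 *)

Hypothesis pd_i : forall X : A, pdle 1 (i X).

Lemma pdle1_ker_e (X : B) : is_zero (e X) -> pdle 1 X.
Proof. by move=> /(rec_ker rec) [Y YX]; apply: pdle_iso YX _. Qed.

(* The cokernel Z of r f lies in Ker e; a presentation 0 -> L -> Q -> Z -> 0
   with L projective lifts Q -> r Y through r f, as maps to r X extend uniquely
   from L to Q, so Z = 0. *)
Lemma rec_r_epi (X Y : C) (f : hom X Y) : is_epi f -> is_epi (fmap r f).
Proof.
move=> fe; have [Z [c fc]] := has_cokernels (abelianP B) (fmap r f).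
have ce := cokernel_epi fc.
(* Full faithfulness of [r] writes [u c] as [r w]; then [w f = 0], and [f] is epi. *)
have eZ : is_zero (e Z).
  apply: (is_zero_ladj er) => W u; apply: (epi0 ce).
  have [w wu] := ff_surj (@rec_r_ff _ _ _ rec) (u \oc c).
  rewrite -wu -(radj_fmap0 er); congr fmap; apply: (epi0 fe).
  apply: (ff_inj (@rec_r_ff _ _ _ rec)); rewrite fmap_comp wu -compA (proj1 fc).
  by rewrite compm0 (radj_fmap0 er).
have [L [Q [k [pi [kpi Qp Lp]]]]] := pdle1_ker_e eZ.
have [t ct] := Qp _ _ _ pi ce.
have [s fs] : exists s, fmap r f \oc s = t \oc k.
  by apply: (cokernel_projective_lift Lp fc); rewrite compA ct (proj1 (proj1 kpi)).
have [s' s's] := adj_surj er s.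
have [eK _] := rec_e_ses kpi.
(* Since [e Z = 0], [e k] is invertible, so [s] extends along [k] to the adjunct of [s' v]. *)
have [v ekv] : exists v, fmap e k \oc v = idm (e Q).
  by apply: (kernel_lift eK); rewrite (proj2 (eZ _) (_ \oc _)).
have vek : v \oc fmap e k = idm (e L).
  by apply: (kernel_mono eK); rewrite compA ekv comp1m compm1.
have sk : adj er (s' \oc v) \oc k = s by rewrite -adj_compl -compA vek compm1.
(* Both maps restrict to [t k] on [L], so their difference factors through [Z]; maps from [Z] to
   [r Y] vanish because [e Z = 0]. *)
have [w wpi] : exists w, w \oc pi = t - fmap r f \oc adj er (s' \oc v).
  apply: (epi_desc (proj2 kpi) (proj1 kpi)).
  by rewrite compBl -compA sk fs subrr.
have pi0 : pi = 0.
  rewrite -ct -(subrK (fmap r f \oc adj er (s' \oc v)) t) -wpi.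
  rewrite (hom_radj_eq0 er w eZ) comp0m add0r compA (proj1 fc).
  exact: comp0m.
have c0 : c = 0.
  rewrite -(comp1m c); rewrite (epi0 (u := idm Z) (proj2 kpi)) ?comp0m //.
  by rewrite pi0 compm0.
apply: is_epi0 => W u uf; have [u' <-] := cokernel_desc fc uf.
by rewrite c0 compm0.
Qed.

Lemma rec_e_projective (X : B) : is_projective X -> is_projective (e X).
Proof. by apply: (ladj_projective er) => Y Y' f; apply: rec_r_epi. Qed.

Lemma pdle_rec_e n (X : B) : pdle n X -> pdle n (e X).
Proof.
elim: n X => [|n IH] X; first exact: rec_e_projective.
move=> [K [P [k [f [kf Pp Kn]]]]].
exists (e K), (e P), (fmap e k), (fmap e f); split.
- exact: rec_e_ses.
- exact: rec_e_projective.
- exact: IH.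
Qed.

Lemma pdle2_rec_e_projective (X : B) : is_projective (e X) -> pdle 2 X.
Proof.
move=> eXp; have [eps epsE] := adj_surj le (idm (e X)).
have [M [m km]] := has_kernels (abelianP B) eps.
have [N [c kc]] := has_cokernels (abelianP B) eps.
apply: (pdle2_kernel_cokernel (rec_l_projective eXp) km kc); apply: pdle1_ker_e.
  (* For the kernel [M] of the counit [eps]: [m u] is [l w] by full faithfulness of [l], and [w] is
     the adjunct of [eps m u = 0]. *)
  apply: (is_zero_radj le) => W u; apply: (mono0 (kernel_mono km)).
  have [w wmu] := ff_surj (@rec_l_ff _ _ _ rec) (m \oc u).
  rewrite -wmu -(comp1m w) -epsE -adj_compl wmu compA (proj1 km) comp0m adj0.
  exact: (ladj_fmap0 le).
(* For the cokernel [N]: the map [v] adjunct to [u c] kills [e eps], a split epimorphism by the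
   triangle identity. *)
apply: (is_zero_ladj er) => W u; apply: (epi0 (cokernel_epi kc)).
have [v vuc] := adj_surj er (u \oc c).
have veps : v \oc fmap e eps = 0.
  by apply: (adj_eq0 (a := er)); rewrite adj_compl vuc -compA (proj1 kc) compm0.
have esplit : fmap e eps \oc adj le (idm (l (e X))) = idm (e X).
  by rewrite -adj_compr compm1.
by rewrite -vuc -(compm1 v) -esplit compA veps comp0m adj0.
Qed.

(** The functor [e] sends a projective presentation of [X] to one of [e X], so by Schanuel the bound
    for the syzygy [e K] drops by one. *)
Lemma pdle_rec_e_add2 (projB : enough_projectives B) n (X : B) :
  pdle n (e X) -> pdle n.+2 X.
Proof.
elim: n X => [|n IH] X; first exact: pdle2_rec_e_projective.
move=> eXn; have [P [f [Pp fe]]] := projB X.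
have [K [k kf]] := has_kernels (abelianP B) f.
exists K, P, k, f; split=> //; apply: IH.
exact: pdle_syzygy (rec_e_projective Pp) (rec_e_ses (conj kf fe)) eXn.
Qed.

End Recollement.

Local Open Scope classical_set_scope.
Local Open Scope ereal_scope.

(** * Dimensions as extended reals *)

Section Dimension.
Variables (R : realType) (C : abelian_category).
Implicit Types X : C.

Lemma pd_pdle n X : pdle n X -> pd R X <= n%:R%:E.
Proof.
move=> Xn; apply: ereal_inf_lbound; exists n => //.
exact/has_proj_resolution_pdle.
Qed.

(** An infimum of a nonempty set of naturals is attained at its least element. *)
Lemma pd_ltyE X : pd R X < +oo -> exists2 n, pdle n X & pd R X = n%:R%:E.
Proof.
move=> /ereal_inf_lt [_ [m Xm _] _].
have ex : exists n, `[< pdle n X >].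
  by exists m; apply/asboolP/has_proj_resolution_pdle.
case: (ex_minnP ex) => n /asboolP Xn nmin; exists n => //.
apply/eqP; rewrite eq_le pd_pdle //=.
apply: le_ereal_inf_tmp => _ [k Xk <-]; rewrite lee_fin ler_nat; apply: nmin.
exact/asboolP/has_proj_resolution_pdle.
Qed.

Lemma pd_le_Findim X : pd R X < +oo -> pd R X <= Findim R C.
Proof. by move=> Xfin; apply: ereal_sup_ubound; exists X. Qed.

End Dimension.

Theorem theorem5p5 (R : realType) (A B C : abelian_category)
    (rec : recollement A B C)
    (projA : enough_projectives A) (injA : enough_injectives A)
    (projB : enough_projectives B) (injB : enough_injectives B)
    (projC : enough_projectives C) (injC : enough_injectives C)
    (hpgl : pgldim R rec <= 1) :
  (maxe (Findim R A) (Findim R C) <= Findim R B /\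
   Findim R B <= Findim R C + 2%:E) /\
  (Findim R B < +oo <-> Findim R C < +oo).
Proof.
have pd_i1 X : exists n,
    [/\ (n <= 1)%N, pdle n (rec_i rec X) & pd R (rec_i rec X) = n%:R%:E].
  have pdX : pd R (rec_i rec X) <= 1.
    by apply: le_trans hpgl; apply: ereal_sup_ubound; exists X.
  have [|n Xn pdE] := @pd_ltyE R _ (rec_i rec X).
    exact: le_lt_trans pdX (ltry _).
  by exists n; split=> //; move: pdX; rewrite pdE lee_fin lern1.
have pd_i X : pdle 1 (rec_i rec X).
  have [n [n1 /has_proj_resolution_pdle [P [d [a [res P0]]]] _]] := pd_i1 X.
  (* Monotonicity in the bound is read off from resolutions: vanishing beyond [n] gives vanishing
     beyond 1. *)
  apply/has_proj_resolution_pdle; exists P, d, a; split=> // k k1.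
  exact/P0/leq_ltn_trans/k1.
have leA : Findim R A <= Findim R B.
  apply: ge_ereal_sup => _ [X _ <-]; have [n [n1 Xn pdE]] := pd_i1 X.
  apply: le_trans (pd_pdle R (pdle_rec_i injA n1 Xn)) _.
  (* The bound [n] is exactly the dimension of [i X], an object counted in [Findim R B]. *)
  by rewrite -pdE pd_le_Findim // pdE ltry.
have leC : Findim R C <= Findim R B.
  apply: ge_ereal_sup => _ [X /pd_ltyE [n Xn _] <-].
  have Xel := unit_iso (rec_adj_le rec) X (@rec_l_ff _ _ _ rec).
  (* The bound [n.+2] serves only to show that [l X] has finite dimension; its exact dimension [m]
     then bounds that of [X], isomorphic to [e (l X)]. *)
  have lXn := pdle_rec_e_add2 pd_i projB (pdle_iso Xel Xn).
  have lXfin := le_lt_trans (pd_pdle R lXn) (ltry _).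
  have [m lXm pdE] := pd_ltyE lXfin.
  apply: le_trans (pd_le_Findim lXfin); rewrite pdE; apply: pd_pdle.
  apply: pdle_iso (pdle_rec_e pd_i lXm).
  by case: Xel => f [g [gf fg]]; exists g, f.
have leB : Findim R B <= Findim R C + 2%:E.
  apply: ge_ereal_sup => _ [X /pd_ltyE [n Xn _] <-].
  (* Finiteness of the dimension of [e X] is what lets it count in [Findim R C]. *)
  have eXfin := le_lt_trans (pd_pdle R (pdle_rec_e pd_i Xn)) (ltry _).
  have [m eXm pdE] := pd_ltyE eXfin.
  apply: le_trans (pd_pdle R (pdle_rec_e_add2 pd_i projB eXm)) _.
  by rewrite -addn2 natrD EFinD -pdE leeD2r // pd_le_Findim.
split; first by rewrite ge_max leA leC.
split=> fin; first exact: le_lt_trans fin.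
by apply: le_lt_trans leB _; rewrite lte_add_pinfty // ltry.
Qed.
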